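(* For every $\alpha>0$ and every SNR $\Gamma>0$, the MP$\alpha$E exponent per unit bandwidth satisfies \[ F_{\alpha}(\Gamma)\leq\min\left\{ 2E_{0}(\alpha,\Gamma),\ \gamma_{\alpha}\Gamma\right\}, \] where \[ E_{0}(\rho,\Gamma)=\frac{1}{2}\left[(1-\beta_{0})(1+\rho)+\Gamma+\log\left(\beta_{0}-\frac{\Gamma}{1+\rho}\right)+\rho\log(\beta_{0})\right],\qquad \beta_{0}=\frac{1}{2}\left(1+\frac{\Gamma}{1+\rho}\right)\left[1+\sqrt{1-\frac{4\Gamma\rho}{(1+\rho+\Gamma)^{2}}}\right]. \]
   Context: Setting: a parameter $u\in[0,1)$ is to be conveyed over the continuous-time AWGN channel $y(t)=s(t,u)+z(t)$, where $z(t)$ is white Gaussian noise with two-sided spectral density $N_0/2$. A modulation–estimation system $\mathcal{S}_T$ of duration $T$ consists of a measurable modulator $u\mapsto s(\cdot,u)$ with $s(t,u)=0$ outside $[0,T]$, and an estimator mapping the received $\{y(t),0\le t\le T\}$ to an estimate $\hat u$. It is power-limited to $P$ if $\frac1T\int_0^T s^2(t,u)\,dt\le P$ for all $u$, and band-limited to $W$ if there is an orthonormal set $\{\phi_n\}_{n=1}^{N}$ of functions on $[0,T]$, $N=2WT$, such that every $s(\cdot,u)$ is a linear combination $\sum_{n=1}^N s_n(u)\phi_n(t)$. For $\alpha>0$ the mean power-$\alpha$ error (MP$\alpha$E) is $e_\alpha(\mathcal{S}_T)=\sup_{u\in[0,1)}\mathbb{E}_u|\hat u-u|^\alpha$ (expectation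 over the noise when the parameter is $u$). $E$ is an achievable MP$\alpha$E exponent if there is a family $\{\mathcal{S}_T\}$ (power-limited to $P$, band-limited to $W$) with $\limsup_{T\to\infty}[-\frac1T\log e_\alpha(\mathcal{S}_T)]\ge E$; $E_\alpha(P/N_0,W)$ is the largest achievable exponent. With the SNR $\Gamma=P/(N_0W)$, this exponent has the form $E_\alpha(P/N_0,W)=W\cdot F_\alpha(\Gamma)$, and $F_\alpha(\Gamma)$ is called the MP$\alpha$E exponent per unit bandwidth. The unlimited-bandwidth MP$\alpha$E exponent is $\gamma_\alpha=\lim_{\Gamma\to0}F_\alpha(\Gamma)/\Gamma$; equivalently, for systems without a bandwidth constraint the optimal MP$\alpha$E decays as $\exp(-\gamma_\alpha PT/N_0)$ to first order in the exponent. Logarithms are natural. *)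

(* Defs.v *)
From HB Require Import structures.
From mathcomp Require Import all_boot all_order all_algebra.
From mathcomp Require Import all_classical all_reals all_analysis.
Set Implicit Arguments. Unset Strict Implicit. Unset Printing Implicit Defensive.
Import Order.TTheory GRing.Theory Num.Theory.
Import numFieldNormedType.Exports.
Local Open Scope classical_set_scope.
Local Open Scope ring_scope.

(* White Gaussian noise in coordinates.  The noise z(t) on [0,T], expanded  *)
(* in a complete orthonormal system of L^2[0,T] whose first N members are   *)
(* the band-limiting functions phi_1..phi_N, has i.i.d. N(0, N0/2)           *)
(* coordinates.  We take a standard i.i.d. N(0,1) sequence G on a            *)
(* probability space and set z_n = sqrt(N0/2) * G n.                        *)

Definition std_gaussian_iid {R : realType} {d : measure_display}
  {Omega : measurableType d} (P : probability Omega R) (G : nat -> Omega -> R)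
  : Prop :=
  (forall n, measurable_fun setT (G n)) /\
  (forall n (B : set R), measurable B ->
      P (G n @^-1` B) = normal_prob 0 1 B) /\
  (* mutual independence: product rule over every finite subfamily
     (it suffices to take prefixes, using B i = setT for unused indices) *)
  (forall (n : nat) (B : nat -> set R), (forall i, measurable (B i)) ->
      P (\bigcap_(i in `I_n) (G i @^-1` B i)) =
      (\prod_(i < n) P (G i @^-1` B i))%E).

Definition cylinders {R : realType} : set (set (nat -> R)) :=
  [set C | exists (n : nat) (B : set R), measurable B /\ C = [set y | B (y n)]].

Definition cyl_measurable {R : realType} (A : set (nat -> R)) : Prop :=
  <<s (@cylinders R) >> A.

Definition estimator_measurable {R : realType} (est : (nat -> R) -> R) : Prop :=
  forall B : set R, measurable B -> cyl_measurable (est @^-1` B).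

(* A modulation-estimation system: modulator u |-> (s_n(u))_n (coordinates *)
(* of s(.,u) in the orthonormal basis) and an estimator.                    *)
Definition system (R : realType) : Type := ((R -> nat -> R) * ((nat -> R) -> R))%type.

Definition ndim {R : realType} (W T : R) : nat := Num.truncn (2 * W * T).

Definition admissible {R : realType} (P W T : R) (S : system R) : Prop :=
  let s := S.1 in let est := S.2 in
  (forall n, measurable_fun (`[0, 1[%classic : set R) (fun u => s u n)) /\
  (* band-limited to W: only the first N = 2WT coordinates are used *)
  (forall u n, u \in `[0, 1[ -> (ndim W T <= n)%N -> s u n = 0) /\
  (* power-limited to P: (1/T) int_0^T s^2 = (1/T) sum_n s_n^2 <= P *)
  (forall u, u \in `[0, 1[ ->
      T^-1 * (\sum_(n < ndim W T) (s u n) ^+ 2) <= P) /\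
  estimator_measurable est.

Definition received {R : realType} {d : measure_display} {Omega : measurableType d}
  (G : nat -> Omega -> R) (N0 : R) (s : R -> nat -> R) (u : R) (w : Omega)
  : nat -> R :=
  fun n => s u n + Num.sqrt (N0 / 2) * G n w.

Definition mpae {R : realType} {d : measure_display} {Omega : measurableType d}
  (P : probability Omega R) (G : nat -> Omega -> R) (N0 alpha : R) (S : system R)
  : \bar R :=
  ereal_sup [set (\int[P]_w (`| S.2 (received G N0 S.1 u w) - u | `^ alpha)%:E)%E
            | u in `[0, 1[ ].

Definition eneglog {R : realType} (e : \bar R) : \bar R :=
  match e with
  | r%:E => if r == 0 then +oo%E else (- ln r)%:E
  | +oo%E => -oo%E
  | -oo%E => +oo%E
  end.

Definition limsup_pinfty {R : realType} (f : R -> \bar R) : \bar R :=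
  ereal_inf [set ereal_sup [set f T | T in `[M, +oo[ ] | M in [set: R]].

Definition achievable {R : realType} {d : measure_display} {Omega : measurableType d}
  (P : probability Omega R) (G : nat -> Omega -> R)
  (alpha Pw N0 W E : R) : Prop :=
  exists Sfam : R -> system R,
    (forall T, 0 < T -> admissible Pw W T (Sfam T)) /\
    (E%:E <= limsup_pinfty
               (fun T => (eneglog (mpae P G N0 alpha (Sfam T)) * (T^-1)%:E)%E))%E.

Definition mpae_exponent {R : realType} {d : measure_display} {Omega : measurableType d}
  (P : probability Omega R) (G : nat -> Omega -> R)
  (alpha Pw N0 W : R) : \bar R :=
  ereal_sup [set E%:E | E in achievable P G alpha Pw N0 W].

(* F_alpha(Gamma) = E_alpha(P/N0, W) / W, evaluated at N0 = 1, W = 1, P = Gamma. *)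
Definition F_exp {R : realType} {d : measure_display} {Omega : measurableType d}
  (P : probability Omega R) (G : nat -> Omega -> R) (alpha Gamma : R) : \bar R :=
  mpae_exponent P G alpha Gamma 1 1.

Definition beta0 {R : realType} (rho Gamma : R) : R :=
  2^-1 * (1 + Gamma / (1 + rho)) *
  (1 + Num.sqrt (1 - 4 * Gamma * rho / (1 + rho + Gamma) ^+ 2)).

Definition E0 {R : realType} (rho Gamma : R) : R :=
  2^-1 * ((1 - beta0 rho Gamma) * (1 + rho) + Gamma
          + ln (beta0 rho Gamma - Gamma / (1 + rho))
          + rho * ln (beta0 rho Gamma)).

(* Main.v *)
Require Import Defs.
From HB Require Import structures.
From mathcomp Require Import all_boot all_order all_algebra.
From mathcomp Require Import all_classical all_reals all_analysis.
From mathcomp Require Import measurable_realfun ring lra.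
Import Order.TTheory GRing.Theory Num.Theory.
Import numFieldNormedType.Exports.
Local Open Scope classical_set_scope.
Local Open Scope ring_scope.

(** For the bound [2 * E0], fix rho > alpha, put lam = 1 / (1 + rho), and compare
    every signal with one reference law of the observation, under which the N
    signal coordinates are centered Gaussian with v times the noise variance.
    Let L_u be the likelihood ratio of the law under parameter u with respect to
    the reference law.  For an error g > 0 and every t > 0,
      [L_u `^ lam <= t * L_u * g + t `^ (- 1 / rho) * g `^ (- 1 / rho)].
    Take g = |est - u|^alpha (truncated away from 0), integrate against the
    reference law and average over a fine grid of parameters u.  The first term
    becomes at most t times the mean power-alpha error; the second is bounded by a
    constant because |x - u|^(- alpha / rho) has a bounded average over u.  The left
    side is an explicit Gaussian integral depending only on the energy of the
    signal.  Optimizing over t gives error >= c * exp (- T * exponent_bound v Gamma rho)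
    with c independent of T; let rho decrease to alpha and choose v optimally.

    For the bound by gamma_alpha, stretching a system in time by 1/c keeps its
    energy and multiplies both power and exponent by c, so F(Gamma) / Gamma is
    nonincreasing in Gamma. *)

(** * Densities *)

Section density.
Local Open Scope ereal_scope.
Context {d : measure_display} {T : measurableType d} {R : realType}.
Import HBNNSimple.

(** Both sides are limits along simple functions increasing to [h], by monotone convergence, and for
    indicators the identity is the hypothesis on [nu]. *)
Lemma integral_density (mu nu : {measure set T -> \bar R}) (f : T -> R)
    (D : set T) (h : T -> \bar R) :
  measurable_fun [set: T] f -> (forall x, (0 <= f x)%R) ->
  (forall A, measurable A -> nu A = \int[mu]_(x in A) (f x)%:E) ->
  measurable D -> measurable_fun D h -> (forall x, 0 <= h x) ->
  \int[nu]_(x in D) h x = \int[mu]_(x in D) (h x * (f x)%:E).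
Proof.
move=> mf f0 nuE mD mh h0.
have mfE : measurable_fun D (EFin \o f).
  exact/measurable_EFinP/measurable_funTS.
pose g := nnsfun_approx mD mh.
have mg n : measurable_fun D (EFin \o g n).
  exact/measurable_EFinP/measurable_funTS/measurable_funP.
have gh x : D x -> (g n x)%:E @[n --> \oo] --> h x.
  by move=> Dx; exact: cvg_nnsfun_approx.
have gS x n m : (n <= m)%N -> (g n x)%:E <= (g m x)%:E.
  by move=> nm; rewrite lee_fin; exact/lefP/nd_nnsfun_approx.
transitivity (limn (fun n => \int[nu]_(x in D) (g n x)%:E)).
  rewrite -monotone_convergence//.
  - by apply: eq_integral => x /[!inE] Dx; apply/esym/cvg_lim => //; exact: gh.
  - by move=> n x _; rewrite lee_fin.
  - by move=> x _ n m nm; apply: gS.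
transitivity (limn (fun n => \int[mu]_(x in D) ((g n x)%:E * (f x)%:E))); last first.
  rewrite -monotone_convergence//.
  - apply: eq_integral => x /[!inE] Dx; apply/cvg_lim => //.
    by apply: cvgeZr => //; exact: gh.
  - by move=> n; apply: emeasurable_funM; [exact: mg|exact: mfE].
  - by move=> n x _; rewrite mule_ge0// lee_fin.
  - by move=> x _ n m nm; rewrite lee_wpmul2r ?lee_fin//; exact: gS.
congr (limn _); apply/funext => n.
under eq_integral do rewrite fimfunE -fsumEFin//.
rewrite ge0_integral_fsum//; last 2 first.
  - by move=> y; exact/measurable_EFinP/measurable_funTS/measurable_funM.
  - by move=> y x _; rewrite nnfun_muleindic_ge0.
under [RHS]eq_integral => x _.
  rewrite fimfunE -fsumEFin// ge0_mule_fsuml; last by move=> r; exact: nnfun_muleindic_ge0.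
  over.
rewrite ge0_integral_fsum//; last 2 first.
  - move=> y; apply: emeasurable_funM => //.
    exact/measurable_EFinP/measurable_funTS/measurable_funM.
  - by move=> y x _; rewrite mule_ge0 ?lee_fin// -lee_fin nnfun_muleindic_ge0.
apply: eq_fsbigr => r /[!inE] -[t _ <-].
under [RHS]eq_integral do rewrite EFinM -muleA.
rewrite ge0_integralZl//; last 3 first.
  - apply: emeasurable_funM => //; exact/measurable_EFinP/measurable_funTS.
  - by move=> x _; rewrite mule_ge0 ?lee_fin.
  - by rewrite lee_fin.
rewrite integralZl_indic_nnsfun// integral_indic//=; congr (_ * _).
rewrite nuE; last exact: measurableI.
rewrite setIC integral_mkcondr; apply: eq_integral => x _.
by rewrite epatch_indic muleC.
Qed.

End density.

(** * Gaussian likelihood ratios *)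

Section gaussian_likelihood_ratio.
Context {R : realType}.
Implicit Types a b x : R.

(** The density of the normal law with mean a and standard deviation b with respect to the standard
    normal law. *)
Definition gauss_lr a b x : R :=
  b^-1 * expR (x ^+ 2 / 2 - (x - a) ^+ 2 / (2 * b ^+ 2)).

Lemma gauss_lr_ge0 a b x : 0 < b -> 0 <= gauss_lr a b x.
Proof. by move=> b0; rewrite mulr_ge0 ?expR_ge0// invr_ge0 ltW. Qed.

Lemma measurable_gauss_lr a b : measurable_fun [set: R] (gauss_lr a b).
Proof.
apply: measurable_funM => //; apply: measurableT_comp => //.
apply: measurable_funB; apply: measurable_funM => //.
apply: measurable_funX; exact: measurable_funB.
Qed.

Lemma normal_pdf_gauss_lr a b x : 0 < b ->
  normal_pdf a b x = gauss_lr a b x * normal_pdf 0 1 x.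
Proof.
move=> b0; have b0' : b != 0 by rewrite gt_eqF.
rewrite !normal_pdfE ?oner_eq0// /normal_fun /normal_peak /gauss_lr.
rewrite mulrACA -expRD -mulrnAr sqrtrM ?sqr_ge0// sqrtr_sqr gtr0_norm// invfM.
rewrite expr1n mul1r; congr (_ * _ * expR _).
by field.
Qed.

Lemma normal_prob_affine a b (B : set R) : 0 < b -> measurable B ->
  normal_prob 0 1 ((fun x => a + b * x) @^-1` B) = normal_prob a b B.
Proof.
move=> b0 mB; have b0' : b != 0 by rewrite gt_eqF.
pose phi (x : measurableTypeR R) : measurableTypeR R := a + b * x.
have mphi : measurable_fun [set: measurableTypeR R] phi.
  by apply: measurable_funD => //; exact: measurable_funM.
pose bn : {nonneg R} := NngNum (ltW b0).
pose mu : {measure set (measurableTypeR R) -> \bar R} := lebesgue_measure.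
(* The substitution rule for [phi]: Lebesgue measure is b times its image under [phi]. By uniqueness
   it is enough to compare half-open intervals. *)
have lebE A : measurable A -> mu A = mscale bn (pushforward mu phi) A.
  move=> mA; apply: lebesgue_measure_unique => //= _ [[x y]] _ <-.
  rewrite /mscale /= /pushforward.
  rewrite (_ : phi @^-1` _ = `](x - a) / b, (y - a) / b]%classic); last first.
    apply/seteqP; split => z /=; rewrite !in_itv/= ltr_pdivrMr// ler_pdivlMr//;
    by rewrite /phi; move=> /andP[? ?]; apply/andP; split; lra.
  rewrite !lebesgue_measure_itv/= !lte_fin ltr_pM2r ?invr_gt0// ltrD2r.
  case: ifPn => _; last by rewrite mule0.
  by rewrite -!EFinB -EFinM; congr (_%:E); field.
have mpdf u v : measurable_fun B (fun x => (normal_pdf u v x)%:E).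
  by apply/measurable_EFinP/measurable_funTS; exact: measurable_normal_pdf.
rewrite /normal_prob [RHS](eq_measure_integral (mscale bn (pushforward mu phi))); last first.
  by move=> A mA _; exact: lebE.
rewrite [RHS]ge0_integral_mscale//; last by move=> x _; rewrite lee_fin normal_pdf_ge0.
rewrite [X in (_ * X)%E]ge0_integral_pushforward//;
  last by move=> x _; rewrite lee_fin normal_pdf_ge0.
rewrite -ge0_integralZl//.
- apply: eq_integral => x _ /=; rewrite -EFinM; congr (_%:E).
  rewrite [in RHS]normal_pdf_gauss_lr// !normal_pdfE ?oner_eq0//.
  rewrite /gauss_lr /normal_fun /phi; set p := normal_peak _.
  (* The factor b / b pairs the Jacobian with the normalisation of [gauss_lr], leaving only an
     identity between exponents. *)
  transitivity (p * expR (- (x - 0) ^+ 2 / (1 ^+ 2 *+ 2)) * (b / b)).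
    by rewrite divff// mulr1.
  rewrite [RHS](_ : _ = p * (expR ((a + b * x) ^+ 2 / 2 - (a + b * x - a) ^+ 2 / (2 * b ^+ 2))
    * expR (- (a + b * x - 0) ^+ 2 / (1 ^+ 2 *+ 2))) * (b / b)); last by ring.
  by rewrite -expRD; congr (_ * expR _ * _); field.
- by rewrite -[X in measurable X]setTI; exact: mphi.
- apply/measurable_EFinP/measurable_funTS; apply: measurableT_comp => //.
  exact: measurable_normal_pdf.
- by move=> x _; rewrite lee_fin normal_pdf_ge0.
- exact: mpdf.
- exact: mpdf.
Qed.

Lemma normal_prob_density a b (B : set R) : 0 < b -> measurable B ->
  normal_prob a b B = (\int[normal_prob 0%R 1%R]_(x in B) (gauss_lr a b x)%:E)%E.
Proof.
move=> b0 mB.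
rewrite (@integral_density _ _ _ lebesgue_measure _ (normal_pdf 0 1))//.
- apply: eq_integral => x _; by rewrite -EFinM -normal_pdf_gauss_lr.
- exact: measurable_normal_pdf.
- by move=> x; exact: normal_pdf_ge0.
- apply/measurable_EFinP; apply: measurable_funTS; exact: measurable_gauss_lr.
- by move=> x; rewrite lee_fin gauss_lr_ge0.
Qed.

End gaussian_likelihood_ratio.

Section density_measure.
Context {d : measure_display} {T : measurableType d} {R : realType}.
Variables (mu : {measure set T -> \bar R}) (f : T -> R).
Hypotheses (mf : measurable_fun [set: T] f) (f0 : forall x, 0 <= f x).

(** The two hypotheses are arguments so that the measure structure can be attached to the term
    itself. *)
Definition mdensity of measurable_fun [set: T] f & (forall x, 0 <= f x) :=
  fun A : set T => (\int[mu]_(x in A) (f x)%:E)%E.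

Local Notation nu := (mdensity mf f0).

Let nu0 : nu set0 = 0%E. Proof. by rewrite /mdensity integral_set0. Qed.

Let nu_ge0 A : (0 <= nu A)%E.
Proof. by apply: integral_ge0 => x _; rewrite lee_fin. Qed.

Let nu_sigma_additive : semi_sigma_additive nu.
Proof.
apply: semi_sigma_additive_nng_induced; first exact/measurable_EFinP.
by move=> x; rewrite lee_fin.
Qed.

HB.instance Definition _ := isMeasure.Build _ _ _ nu nu0 nu_ge0 nu_sigma_additive.

End density_measure.

(** * The space of real sequences with its product sigma-algebra *)

Section sequence_space.
Context {R : realType}.

(** Unlike the cylinders, these sets are closed under intersection, so a finite measure is
    determined by its values on them; independence gives exactly these values. *)
Definition rectangles : set (set (nat -> R)) :=
  [set C | exists (n : nat) (B : nat -> set R), (forall i, measurable (B i)) /\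
    C = [set y | forall i, (i < n)%N -> B i (y i)]].

Local Notation rseq := (g_sigma_algebraType rectangles).

Lemma setI_closed_rectangles : setI_closed rectangles.
Proof.
move=> _ _ [n [B [mB ->]]] [m [C [mC ->]]].
pose D (k : nat) (A : nat -> set R) i := if (i < k)%N then A i else setT.
exists (maxn n m), (fun i => D n B i `&` D m C i); split.
  by move=> i; apply: measurableI; rewrite /D; case: ifP.
apply/seteqP; split => y /=; rewrite /D.
  by move=> [By Cy] i _; split; case: ifP => // im; [exact: By|exact: Cy].
by move=> H; split => i im; have := H i; rewrite leq_max im ?orbT => /(_ isT)[].
Qed.

Lemma measurable_rseq d (T : measurableType d) (X : T -> rseq) :
  (forall n, measurable_fun [set: T] (fun t => X t n)) ->
  measurable_fun [set: T] X.
Proof.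
move=> mX; apply: (@measurability _ _ _ _ [set: T] X rectangles) => //.
move=> _ [_ [n [B [mB ->]]] <-]; rewrite setTI.
rewrite (_ : _ @^-1` _ = \bigcap_(i in `I_n) ((fun t => X t i) @^-1` B i)).
  apply: bigcap_measurableType => i _; rewrite -[X in measurable X]setTI.
  exact: mX.
by apply/seteqP; split.
Qed.

Lemma measurable_rseq_coord n : measurable_fun [set: rseq] (fun y : rseq => y n).
Proof.
move=> _ B mB; rewrite setTI; apply: sub_sigma_algebra.
exists n.+1, (fun i => if i == n then B else setT); split.
  by move=> i; case: ifP.
apply/seteqP; split => y /=.
  by move=> By i _; case: eqP => [->|].
by move=> /(_ n); rewrite eqxx; exact.
Qed.

End sequence_space.

Notation rseq R := (g_sigma_algebraType (@rectangles R)).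

(** * Change of measure for finitely many noise coordinates *)

Section change_of_measure.
Context {R : realType} {d : measure_display} {Omega : measurableType d}.
Variables (P : probability Omega R) (G : nat -> Omega -> R).
Hypothesis hG : std_gaussian_iid P G.

Let mG n : measurable_fun [set: Omega] (G n). Proof. exact: hG.1. Qed.

Let lawG n (B : set R) : measurable B -> P (G n @^-1` B) = normal_prob 0 1 B.
Proof. exact: hG.2.1. Qed.

Let indG n (B : nat -> set R) : (forall i, measurable (B i)) ->
  P (\bigcap_(i in `I_n) (G i @^-1` B i)) = (\prod_(i < n) P (G i @^-1` B i))%E.
Proof. exact: hG.2.2. Qed.

Let mGpre n (B : set R) : measurable B -> measurable (G n @^-1` B).
Proof. by move=> mB; rewrite -[X in measurable X]setTI; exact: mG. Qed.

Let upd (B : nat -> set R) n C i := if i == n then C else B i.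

Let mupd B n C : (forall i, measurable (B i)) -> measurable C ->
  forall i, measurable (upd B n C i).
Proof. by move=> mB mC i; rewrite /upd; case: ifP. Qed.

(** By independence, c is the product of the probabilities of the conditions on the coordinates
    other than n. *)
Let rect_split (B : nat -> set R) n m : (n < m)%N -> (forall i, measurable (B i)) ->
  exists2 c : R, 0 <= c & forall C, measurable C ->
    P (\bigcap_(i in `I_m) (G i @^-1` upd B n C i)) = (c%:E * normal_prob 0%R 1%R C)%E.
Proof.
move=> nm mB; pose c := (\prod_(i < m | i != Ordinal nm) P (G i @^-1` B i))%E.
have c0 : (0 <= c)%E by apply: prode_ge0 => i _; exact: measure_ge0.
have cfin : c \is a fin_num.
  by apply: prode_fin_num => i _; apply: fin_num_measure; exact: mGpre.
exists (fine c); first exact: fine_ge0.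
move=> C mC; rewrite fineK// indG; last exact: mupd.
rewrite (bigD1 (Ordinal nm))//= {1}/upd eqxx lawG// muleC; congr (_ * _)%E.
apply: eq_bigr => i /negbTE; rewrite /upd.
by rewrite -(inj_eq val_inj)/= => ->.
Qed.

(** This stands in for Fubini. [P] restricted to the conditions on the other coordinates and pushed
    forward along [G n] is c times the standard normal law. The identity of [rect_split] is repeated
    so that both use the same c. *)
Let rect_integral (B : nat -> set R) n m (h : R -> R) :
  (n < m)%N -> (forall i, measurable (B i)) ->
  measurable_fun [set: R] h -> (forall x, 0 <= h x) ->
  exists2 c : R, 0 <= c &
    (\int[P]_(w in \bigcap_(i in `I_m) (G i @^-1` B i)) (h (G n w))%:E =
     c%:E * \int[normal_prob 0%R 1%R]_(x in B n) (h x)%:E)%E /\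
    forall C, measurable C ->
    P (\bigcap_(i in `I_m) (G i @^-1` upd B n C i)) = (c%:E * normal_prob 0%R 1%R C)%E.
Proof.
move=> nm mB mh h0; have [c c0 cE] := rect_split B n m nm mB.
exists c => //; split => //.
pose A := \bigcap_(i in `I_m) (G i @^-1` upd B n setT i).
have mA : measurable A.
  by apply: bigcap_measurableType => i _; apply: mGpre; exact: mupd.
have capA C : G n @^-1` C `&` A = \bigcap_(i in `I_m) (G i @^-1` upd B n C i).
  apply/seteqP; split => w /=.
    by move=> [Cw Aw] i im; have := Aw i im; rewrite /= /upd; case: eqP => // ->.
  move=> H; split; first by have := H n nm; rewrite /= /upd eqxx.
  by move=> i im; have := H i im; rewrite /= /upd; case: eqP.
have -> : \bigcap_(i in `I_m) (G i @^-1` B i) = G n @^-1` B n `&` A.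
  rewrite capA; apply: eq_bigcapr => i _; rewrite /upd.
  by case: eqP => // ->.
have mhG : measurable_fun (G n @^-1` B n) (fun w => (h (G n w))%:E).
  by apply/measurable_EFinP/measurable_funTS; exact: measurableT_comp.
rewrite integral_mkcondr.
transitivity (\int[P]_(w in G n @^-1` B n) ((h (G n w))%:E * (\1_A w)%:E))%E.
  by apply: eq_integral => w _; rewrite epatch_indic.
rewrite -(@integral_density _ _ _ P (mrestr P mA))//; last 3 first.
  - by move=> S mS; rewrite (integral_indic P mS mA) setIC.
  - exact: mGpre.
  - by move=> w; rewrite lee_fin.
pose cn : {nonneg R} := NngNum c0.
pose Gn : Omega -> measurableTypeR R := G n.
have mGn : measurable_fun [set: Omega] Gn by exact: mG.
rewrite -(@ge0_integral_pushforward _ _ _ _ _ Gn mGn (mrestr P mA) (B n) (EFin \o h))//; last 2 first.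
  - exact/measurable_EFinP/measurable_funTS.
  - by move=> x _; rewrite lee_fin.
rewrite [LHS](eq_measure_integral (mscale cn (normal_prob 0 1))).
  rewrite [LHS]ge0_integral_mscale//=; last 2 first.
  - exact/measurable_EFinP/measurable_funTS.
  - by move=> x _; rewrite lee_fin.
  exact: mB.
- by move=> C mC _; rewrite -[LHS]/(P (G n @^-1` C `&` A)) capA cE.
- exact: mB.
Qed.

(** The law of the modified sequence under [P] and the law of the noise under [P] weighted by the
    likelihood ratio agree on rectangles, hence on all measurable sets. *)
Lemma change_of_measure1 n a b (Phi : rseq R -> \bar R) : 0 < b ->
  measurable_fun [set: rseq R] Phi -> (forall y, 0 <= Phi y)%E ->
  (\int[P]_w Phi (fun i => if i == n then (a + b * G i w)%R else G i w) =
   \int[P]_w (Phi (fun i => G i w) * (gauss_lr a b (G n w))%:E))%E.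
Proof.
move=> b0 mPhi Phi0.
pose X w : rseq R := fun i => G i w.
pose X' w : rseq R := fun i => if i == n then a + b * G i w else G i w.
have mX : measurable_fun [set: Omega] X by exact: measurable_rseq.
have mX' : measurable_fun [set: Omega] X'.
  apply: measurable_rseq => i; rewrite /X'; case: eqP => // _.
  by apply: measurable_funD => //; exact: measurable_funM.
have mf : measurable_fun [set: Omega] (fun w => gauss_lr a b (G n w)).
  by apply: measurableT_comp => //; exact: measurable_gauss_lr.
have f0 w : 0 <= gauss_lr a b (G n w) by exact: gauss_lr_ge0.
pose nu : {measure set Omega -> \bar R} := mdensity P _ mf f0.
have lawE A : measurable A -> pushforward P X' A = pushforward nu X A.
  apply: (@measure_unique _ R (rseq R) rectangles (fun=> setT)) => //.
  - exact: setI_closed_rectangles.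
  - by move=> _; exists 0%N, (fun=> setT); split => //; apply/seteqP; split.
  - by rewrite bigcup_const.
  - move=> _ [m [B [mB ->]]].
    (* Padding with [setT] up to [m'] brings coordinate n into range even when n is at least m. *)
    pose B' i := if (i < m)%N then B i else setT.
    have mB' i : measurable (B' i) by rewrite /B'; case: ifP.
    pose m' := maxn m n.+1.
    have nm' : (n < m')%N by rewrite leq_max leqnn orbT.
    have preX : X @^-1` [set y | forall i, (i < m)%N -> B i (y i)] =
        \bigcap_(i in `I_m') (G i @^-1` B' i).
      apply/seteqP; split => w /=.
        by move=> H i _; rewrite /= /B'; case: ifP => // /H.
      move=> H i im; have := H i; rewrite /= /B' im; apply.
      by rewrite leq_max im.
    have preX' : X' @^-1` [set y | forall i, (i < m)%N -> B i (y i)] =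
        \bigcap_(i in `I_m') (G i @^-1` upd B' n ((fun x => a + b * x) @^-1` B' n) i).
      apply/seteqP; split => w /=.
        move=> H i _; rewrite /= /upd /B'; case: eqP => [->|/eqP ni].
          case: ifP => //= nm; have := H n nm.
          by rewrite /X' eqxx.
        by case: ifP => // im; have := H i im; rewrite /X' (negbTE ni).
      move=> H i im; have := H i; rewrite /= leq_max im => /(_ isT).
      by rewrite /upd /X'; case: eqP => [ni|_]; [subst i|]; rewrite /= /B' im.
    have [c c0 [cI cE]] := rect_integral B' n m' _ nm' mB'
      (measurable_gauss_lr a b) (fun x => gauss_lr_ge0 a b x b0).
    rewrite -[LHS]/(P (X' @^-1` [set y | forall i, (i < m)%N -> B i (y i)])).
    rewrite -[RHS]/(nu (X @^-1` [set y | forall i, (i < m)%N -> B i (y i)])).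
    rewrite preX preX' cE; last first.
      rewrite -[X in measurable X]setTI.
      have : measurable_fun [set: R] (fun x : R => a + b * x).
        by apply: measurable_funD => //; exact: measurable_funM.
      by apply.
    by rewrite normal_prob_affine// normal_prob_density// -cI.
  - by move=> _; rewrite -[X in (X < _)%E]/(P [set: Omega]) probability_setT ltry.
transitivity (\int[pushforward P X']_y Phi y)%E.
  by rewrite ge0_integral_pushforward.
rewrite (eq_measure_integral (pushforward nu X)); last by move=> A mA _; exact: lawE.
rewrite ge0_integral_pushforward// preimage_setT.
rewrite (@integral_density _ _ _ P nu (fun w => gauss_lr a b (G n w)))//.
  exact: measurableT_comp.
by move=> w; exact: Phi0.
Qed.

End change_of_measure.

Section change_of_measure_prefix.
Context {R : realType} {d : measure_display} {Omega : measurableType d}.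
Variables (P : probability Omega R) (G : nat -> Omega -> R).
Hypothesis hG : std_gaussian_iid P G.

Lemma measurable_affine_prefix N (a : nat -> R) (b c : R) :
  measurable_fun [set: rseq R]
    (fun y : rseq R => (fun i => if (i < N)%N then a i + b * y i else c * y i) : rseq R).
Proof.
apply: measurable_rseq => i; case: (ltnP i N) => _.
  apply: measurable_funD => //; apply: measurable_funM => //.
  exact: measurable_rseq_coord.
by apply: measurable_funM => //; exact: measurable_rseq_coord.
Qed.

(** Induction on N: [change_of_measure1] treats coordinate N, and its likelihood factor joins the
    test function as [Phi'], where the changes to earlier coordinates leave it intact. The tail is
    written [1 * G i w] to match [measurable_affine_prefix]. *)
Lemma change_of_measure N (a : nat -> R) (b : R) (Phi : rseq R -> \bar R) : 0 < b ->
  measurable_fun [set: rseq R] Phi -> (forall y, 0 <= Phi y)%E ->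
  (\int[P]_w Phi (fun i => if (i < N)%N then (a i + b * G i w)%R else (1 * G i w)%R) =
   \int[P]_w (Phi (fun i => G i w) * (\prod_(i < N) gauss_lr (a i) b (G i w))%:E))%E.
Proof.
move=> b0; elim: N Phi => [|N IH] Phi mPhi Phi0.
  apply: eq_integral => w _; rewrite big_ord0 mule1; congr Phi.
  by apply/funext => i; rewrite ltn0 mul1r.
pose Psi y := Phi (fun i => if (i < N)%N then a i + b * y i else 1 * y i).
have mPsi : measurable_fun [set: rseq R] Psi.
  exact: (measurableT_comp mPhi (measurable_affine_prefix N a b 1)).
transitivity (\int[P]_w Psi (fun i => if i == N then (a N + b * G i w)%R else G i w))%E.
  apply: eq_integral => w _; congr Phi; apply/funext => i.
  rewrite ltnS; case: (ltngtP i N) => [||->] //; last by rewrite mul1r.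
rewrite (change_of_measure1 P G hG)//; last by move=> y; exact: Phi0.
pose Phi' (y : rseq R) := (Phi y * (gauss_lr (a N) b (y N))%:E)%E.
transitivity (\int[P]_w Phi' (fun i => if (i < N)%N then (a i + b * G i w)%R else (1 * G i w)%R))%E.
  by apply: eq_integral => w _; rewrite /Phi' ltnn mul1r.
rewrite IH.
- apply: eq_integral => w _; rewrite /Phi' big_ord_recr/= -muleA -EFinM.
  by rewrite (mulrC (gauss_lr _ _ _)).
- apply: emeasurable_funM => //; apply/measurable_EFinP.
  apply: measurableT_comp; first exact: measurable_gauss_lr.
  exact: measurable_rseq_coord.
- by move=> y; rewrite mule_ge0// lee_fin gauss_lr_ge0.
Qed.

Lemma integral_prod_gauss_lr N (a : nat -> R) (b : R) : 0 < b ->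
  (\int[P]_w (\prod_(i < N) gauss_lr (a i) b (G i w))%:E = 1)%E.
Proof.
move=> b0; transitivity (\int[P]_w ((cst 1%E : rseq R -> \bar R) (fun i => G i w) *
    (\prod_(i < N) gauss_lr (a i) b (G i w))%:E))%E.
  by apply: eq_integral => w _; rewrite mul1e.
rewrite -change_of_measure//.
have /= -> := integral_cst P (@measurableT _ Omega) 1%E.
by rewrite probability_setT mule1.
Qed.

(* Completing the square: a power of the likelihood ratio of N(a, b^2) is, up to
   a constant, the likelihood ratio of the Gaussian with precision k. *)
Lemma gauss_lr_powR (a b lam x : R) : 0 < b -> 0 < lam -> lam < 1 ->
  let k := 1 - lam + lam / b ^+ 2 in
  gauss_lr a b x `^ lam =
  expR (- lam * ln b - ln k / 2 - lam * (1 - lam) * a ^+ 2 / (2 * b ^+ 2 * k)) *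
  gauss_lr (lam * a / (b ^+ 2 * k)) (Num.sqrt k)^-1 x.
Proof.
move=> b0 l0 l1 k.
have b2 : 0 < b ^+ 2 by rewrite exprn_gt0.
have k0 : 0 < k by rewrite addr_gt0 ?subr_gt0 ?divr_gt0.
have b0' : b != 0 by rewrite gt_eqF.
have k0' : k != 0 by rewrite gt_eqF.
have sk : Num.sqrt k = expR (ln k / 2).
  by rewrite -powR12_sqrt ?ltW// /powR gt_eqF// mulrC.
have bE : b^-1 = expR (- ln b) by rewrite expRN lnK.
rewrite /gauss_lr invrK exprVn sqr_sqrtr ?(ltW k0)// sk bE.
rewrite -!expRD /powR gt_eqF ?expR_gt0// expRK; congr expR.
have kb : (1 - lam) * b ^+ 2 + lam = k * b ^+ 2 by rewrite /k; field.
set lk := ln k; rewrite /k; field.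
by rewrite b0'/= kb mulf_neq0// gt_eqF.
Qed.

(** By [gauss_lr_powR] each factor is a constant times another Gaussian likelihood ratio, and the
    product of those ratios integrates to 1. *)
Lemma integral_prod_gauss_lr_powR N (a : nat -> R) (b lam : R) :
  0 < b -> 0 < lam -> lam < 1 ->
  let k := 1 - lam + lam / b ^+ 2 in
  (\int[P]_w ((\prod_(i < N) gauss_lr (a i) b (G i w)) `^ lam)%:E =
   (expR (N%:R * (- lam * ln b - ln k / 2)
          - lam * (1 - lam) / (2 * b ^+ 2 * k) * \sum_(i < N) a i ^+ 2))%:E)%E.
Proof.
move=> b0 l0 l1 k.
have k0 : 0 < k by rewrite addr_gt0 ?subr_gt0// divr_gt0// exprn_gt0.
pose C := expR (N%:R * (- lam * ln b - ln k / 2)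
          - lam * (1 - lam) / (2 * b ^+ 2 * k) * \sum_(i < N) a i ^+ 2).
pose a' i := lam * a i / (b ^+ 2 * k).
have sk0 : 0 < (Num.sqrt k)^-1 by rewrite invr_gt0 sqrtr_gt0.
have E w : (\prod_(i < N) gauss_lr (a i) b (G i w)) `^ lam =
    C * \prod_(i < N) gauss_lr (a' i) (Num.sqrt k)^-1 (G i w).
  rewrite /C; elim: N {C} => [|n IH].
    by rewrite !big_ord0 powR1 mul0r mulr0 subr0 expR0 mulr1.
  rewrite !big_ord_recr/= powRM; last 2 first.
    - by apply: prodr_ge0 => i _; exact: gauss_lr_ge0.
    - exact: gauss_lr_ge0.
  rewrite IH gauss_lr_powR// mulrACA -expRD; congr (expR _ * _).
  by rewrite -natr1 -/k; lra.
under eq_integral do rewrite E EFinM.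
rewrite ge0_integralZl//.
- by rewrite integral_prod_gauss_lr// mule1.
- apply/measurable_EFinP; apply: measurable_prod => i _.
  by apply: measurableT_comp; [exact: measurable_gauss_lr|exact: hG.1].
- by move=> w _; rewrite lee_fin; apply: prodr_ge0 => i _; exact: gauss_lr_ge0.
- by rewrite lee_fin expR_ge0.
Qed.

End change_of_measure_prefix.

(** * Averages over a grid of parameters *)

Section grid_sums.
Context {R : realType}.

(* Remove the grid point farthest from y, at distance at least half the
   length of the grid, and induct. *)
Lemma sum_dist_grid_le (phi : R -> R) (M : nat) (y : R) :
  (forall p q, 0 <= p -> p <= q -> phi q <= phi p) ->
  \sum_(j < M) phi `|y - j%:R| <= \sum_(j < M) phi (j%:R / 2).
Proof.
move=> dec; elim: M y => [|M IH] y; first by rewrite !big_ord0.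
have M2 : 0 <= M%:R / 2 :> R by rewrite divr_ge0.
rewrite [leRHS]big_ord_recr/=; have [yM|yM] := leP (M%:R / 2) y.
  rewrite big_ord_recl/= subr0 [leLHS]addrC; apply: lerD; last first.
    by apply: dec => //; rewrite ger0_norm// (le_trans M2).
  apply: le_trans (IH (y - 1)); rewrite le_eqVlt; apply/orP; left; apply/eqP.
  apply: eq_bigr => i _; congr (phi `|_|).
  by rewrite /= /bump/= -natr1; lra.
rewrite big_ord_recr/= lerD//; apply: dec => //.
by rewrite distrC ger0_norm; lra.
Qed.

Lemma sum_powRN_le (beta : R) (M : nat) : 0 < beta -> beta < 1 ->
  \sum_(j < M) (j.+1%:R : R) `^ (- beta) <= M%:R `^ (1 - beta) / (1 - beta).
Proof.
move=> b0 b1; have b1' : 0 < 1 - beta by rewrite subr_gt0.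
elim: M => [|M IH]; first by rewrite big_ord0 divr_ge0 ?powR_ge0// ltW.
rewrite big_ord_recr/=; apply: (le_trans (lerD IH (lexx _))).
set m : R := M.+1%:R; have m0 : 0 < m by rewrite ltr0n.
have mE : m `^ (1 - beta) = m * m `^ (- beta).
  rewrite powRD; last by rewrite gt_eqF ?implybT.
  by rewrite powRr1// ltW.
have MM : M%:R = (M%:R / m) * m by rewrite divfK// gt_eqF.
have r0 : 0 <= M%:R / m by rewrite divr_ge0// ltW.
(* Young's inequality with exponents 1 / (1 - beta) and 1 / beta and second factor 1: the tangent at
   1 of a concave power. *)
have key : (M%:R / m) `^ (1 - beta) <= (1 - beta) * (M%:R / m) + beta.
  have := @conjugate_powR _ ((M%:R / m) `^ (1 - beta)) 1 (1 - beta)^-1 beta^-1.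
  rewrite powR_ge0 ler01 !invr_gt0 b1' b0 !invrK subrK mulr1 powR1 mul1r.
  rewrite -powRrM divff ?gt_eqF// powRr1// => H.
  by rewrite (mulrC (1 - beta)); exact: H.
rewrite {1}MM powRM ?(ltW m0)// mE.
have mb : 0 <= m `^ (- beta) by exact: powR_ge0.
have Mm : M%:R = m - 1 by rewrite /m -natr1 addrK.
rewrite ler_pdivlMr// mulrDl divfK ?gt_eqF//.
apply: (@le_trans _ _ (((1 - beta) * (M%:R / m) + beta) * (m * m `^ (- beta)) +
    m `^ (- beta) * (1 - beta))).
  by rewrite lerD2r ler_wpM2r// mulr_ge0// ltW.
rewrite le_eqVlt; apply/orP; left; apply/eqP; rewrite Mm; field.
by rewrite gt_eqF.
Qed.

(** The kernel is truncated at the mesh 1 / M. Scaling by M gives an integer grid and a decreasing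
    kernel, [sum_dist_grid_le] removes x, and [sum_powRN_le] bounds what is left. *)
Lemma sum_grid_kernel_le (beta x : R) (M : nat) : 0 < beta -> beta < 1 ->
  \sum_(j < M) (Num.max `|x - j%:R / M%:R| M%:R^-1) `^ (- beta) <=
  M%:R * (3 / (1 - beta)).
Proof.
move=> b0 b1; case: M => [|M]; first by rewrite big_ord0 mul0r.
set m : R := M.+1%:R; have m0 : 0 < m by rewrite ltr0n.
have mi0 : 0 < m^-1 by rewrite invr_gt0.
pose phi p : R := (Num.max p 1) `^ (- beta).
have phidec p q : 0 <= p -> p <= q -> phi q <= phi p.
  move=> p0 pq; rewrite /phi !powRN lef_pV2 ?posrE ?powR_gt0 ?lt_max ?ltr01 ?orbT//.
  have max1 z : 0 <= Num.max z (1 : R) by rewrite le_max ler01 orbT.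
  apply: (ge0_ler_powR (ltW b0)); rewrite ?nnegrE//.
  by rewrite ge_max !le_max pq lexx orbT.
have E j : (Num.max `|x - j%:R / m| m^-1) `^ (- beta) = m `^ beta * phi `|m * x - j%:R|.
  have -> : Num.max `|x - j%:R / m| m^-1 = m^-1 * Num.max `|m * x - j%:R| 1.
    rewrite maxr_pMr ?ltW// mulr1; congr Num.max.
    rewrite -{2}(gtr0_norm mi0) -normrM; congr `|_|; field.
    by rewrite gt_eqF.
  rewrite powRM ?(ltW mi0) ?le_max ?ler01 ?orbT//; congr (_ * _).
  by rewrite -(powR_inv1 (ltW m0)) -powRrM mulN1r opprK.
under eq_bigr do rewrite E.
rewrite -mulr_sumr.
apply: (@le_trans _ _ (m `^ beta * (3 * (m `^ (1 - beta) / (1 - beta))))); last first.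
  have -> : m `^ beta * (3 * (m `^ (1 - beta) / (1 - beta))) =
     (m `^ beta * m `^ (1 - beta)) * (3 / (1 - beta)) by ring.
  suff -> : m `^ beta * m `^ (1 - beta) = m by [].
  rewrite -powRD; last by apply/implyP => _; rewrite gt_eqF.
  by rewrite subrKC powRr1 ?(ltW m0).
rewrite ler_wpM2l ?powR_ge0//; apply: (le_trans (sum_dist_grid_le _ _ _ phidec)).
apply: (@le_trans _ _ (3 * \sum_(j < M.+1) (j.+1%:R : R) `^ (- beta))); last first.
  by rewrite ler_wpM2l//; exact: sum_powRN_le.
rewrite mulr_sumr; apply: ler_sum => j _.
rewrite /phi; set n : R := j.+1%:R; have n0 : 0 < n by rewrite ltr0n.
(* Source of the constant 3: for j at most 1 the maximum with 1 suffices, and from j = 2 on (j + 1)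
   / 3 <= j / 2. *)
have nj : n / 3 <= Num.max (j%:R / 2) 1.
  rewrite le_max /n; have [j1|j1] := leqP j 1%N.
    apply/orP; right; have : (j%:R : R) <= 1 by rewrite (ler_nat R j 1).
    by rewrite -(natr1 j); lra.
  apply/orP; left; have : (2 : R) <= j%:R by rewrite ler_nat.
  by rewrite -(natr1 j); lra.
have n30 : 0 < n / 3 by rewrite divr_gt0.
apply: (@le_trans _ _ ((n / 3) `^ (- beta))).
  rewrite !powRN lef_pV2 ?posrE ?powR_gt0 ?lt_max ?ltr01 ?orbT//.
  apply: (ge0_ler_powR (ltW b0)) => //; rewrite nnegrE; first exact: ltW.
  by rewrite le_max ler01 orbT.
rewrite powRM ?(ltW n0) ?invr_ge0// mulrC ler_wpM2r ?powR_ge0//.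
rewrite -(powR_inv1 (ler0n _ 3)) -powRrM mulN1r opprK.
by apply: ler1_powR; [rewrite (ler_nat R 1 3)|exact: ltW].
Qed.

(* Whichever term dominates, one of the two summands alone bounds the left side. *)
Lemma powR_le_tradeoff (rho L g t : R) : 0 < rho -> 0 <= L -> 0 < g -> 0 < t ->
  L `^ (1 + rho)^-1 <= t * (L * g) + t `^ (- rho^-1) * g `^ (- rho^-1).
Proof.
move=> r0 L0 g0 t0; have r1 : 0 < 1 + rho by rewrite addr_gt0.
have R0 : 0 <= t `^ (- rho^-1) * g `^ (- rho^-1) by rewrite mulr_ge0 ?powR_ge0.
have T0 : 0 <= t * (L * g) by rewrite !mulr_ge0 ?(ltW g0) ?(ltW t0).
move: L0; rewrite le_eqVlt => /predU1P[L0|L0].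
  rewrite -{1}L0 powR0; first exact: addr_ge0.
  by rewrite gt_eqF// invr_gt0.
set l := (1 + rho)^-1.
have [le1|lt1] := leP (l * ln L) (ln L + ln (t * g)).
  apply: (@le_trans _ _ (t * (L * g))); last by rewrite lerDl.
  rewrite /powR gt_eqF//; apply: (@le_trans _ _ (expR (ln L + ln (t * g)))).
    by rewrite ler_expR.
  rewrite expRD !lnK ?posrE ?mulr_gt0// le_eqVlt; apply/orP; left; apply/eqP.
  by ring.
apply: (@le_trans _ _ (t `^ (- rho^-1) * g `^ (- rho^-1))); last by rewrite lerDr.
rewrite -powRM ?(ltW t0) ?(ltW g0)// /powR !gt_eqF ?mulr_gt0// ler_expR.
rewrite mulNr -mulrN [leRHS]mulrC ler_pdivlMr//.
have lE : l * (1 + rho) = 1 by rewrite mulVf// gt_eqF.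
have -> : l * ln L * rho = l * (1 + rho) * ln L - l * ln L by ring.
rewrite lE mul1r.
by lra.
Qed.

End grid_sums.

(** * Lower bounds on the error *)

Section error_lower_bound.
Context {R : realType} {d : measure_display} {Omega : measurableType d}.
Variables (P : probability Omega R) (G : nat -> Omega -> R).
Hypothesis hG : std_gaussian_iid P G.

(** A cylinder is a rectangle whose other sides are all [setT], so rectangles generate at least the
    cylinder sigma-algebra. *)
Lemma estimator_measurable_rseq (est : (nat -> R) -> R) :
  estimator_measurable est -> measurable_fun [set: rseq R] (est : rseq R -> R).
Proof.
move=> mest _ B mB; rewrite setTI.
apply: (@sub_sigma_algebra2 _ setT _ cylinders); last exact: mest.
move=> _ [n [A [mA ->]]]; exists n.+1, (fun i => if i == n then A else setT).
split; first by move=> i; case: ifP.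
apply/seteqP; split => y /=; first by move=> Ay i _; case: eqP => [->|].
by move=> /(_ n); rewrite eqxx; exact.
Qed.

Variables (alpha rho v : R).
Hypotheses (alpha0 : 0 < alpha) (rho0 : 0 < rho) (v0 : 0 < v).

Let lam := (1 + rho)^-1.
Let k := 1 - lam + lam * v.
Let sigma : R := Num.sqrt (1 / 2).

Let lam0 : 0 < lam. Proof. by rewrite invr_gt0 addr_gt0. Qed.
Let lam1 : lam < 1. Proof. by rewrite invf_lt1 ?addr_gt0// ltrDl. Qed.
Let sigma0 : 0 < sigma. Proof. by rewrite sqrtr_gt0 divr_gt0. Qed.
Let sv0 : 0 < Num.sqrt v. Proof. by rewrite sqrtr_gt0. Qed.
Let tau0 : 0 < sigma * Num.sqrt v. Proof. by rewrite mulr_gt0. Qed.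
Let k0 : 0 < k. Proof. by rewrite addr_gt0 ?subr_gt0 ?mulr_gt0. Qed.

(* The estimate computed from the reference observation, whose first N
   coordinates are N(0, v/2) and whose other coordinates are pure noise. *)
Let est_ref (est : (nat -> R) -> R) N (y : rseq R) : R :=
  est (fun i => if (i < N)%N then 0 + sigma * Num.sqrt v * y i else sigma * y i).

Lemma measurable_est_ref est N : estimator_measurable est ->
  measurable_fun [set: rseq R] (est_ref est N).
Proof.
move=> /estimator_measurable_rseq mest.
exact: (measurableT_comp mest (measurable_affine_prefix N (fun=> 0) _ _)).
Qed.

Let err (est : (nat -> R) -> R) N u (y : rseq R) : R := `|est_ref est N y - u|.

Let merr est N u : estimator_measurable est ->
  measurable_fun [set: rseq R] (err est N u).
Proof.
move=> mest; apply: measurableT_comp => //; apply: measurable_funB => //.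
exact: measurable_est_ref.
Qed.

Let mmaxpow est N u delta p : estimator_measurable est ->
  measurable_fun [set: rseq R] (fun y => (Num.max (err est N u y) delta) `^ p).
Proof.
move=> mest; apply: (measurableT_comp (measurable_powR p)).
by apply: measurable_maxr => //; exact: merr.
Qed.

Let mGseq : measurable_fun [set: Omega] (fun w => (fun i => G i w) : rseq R).
Proof. by apply: measurable_rseq => i; exact: hG.1. Qed.

(** [powR_le_tradeoff] integrated under the reference law, for one parameter u. The term with L
    becomes the true mean error by [change_of_measure]; truncating the distance at delta keeps g
    positive and adds at most delta^alpha to it. *)
Lemma mpae_tradeoff_pointwise (N : nat) (s : R -> nat -> R) est (Q e t u delta : R) :
  estimator_measurable est -> u \in `[0, 1[ ->
  (forall n, (N <= n)%N -> s u n = 0) -> \sum_(n < N) s u n ^+ 2 <= Q ->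
  mpae P G 1 alpha (s, est) = e%:E -> 0 < t -> 0 < delta ->
  ((expR (N%:R * (lam * ln v / 2 - ln k / 2) - lam * (1 - lam) * Q / k))%:E <=
   (t * (e + delta `^ alpha))%:E +
   (t `^ (- rho^-1))%:E * \int[P]_w
     ((Num.max (err est N u (fun i => G i w)) delta) `^ (- (alpha / rho)))%:E)%E.
Proof.
move=> mest u01 sN sQ mpaeE t0 delta0.
(* In units where the reference signal coordinates are standard normal, those under u have mean
   [a i] and standard deviation b. *)
pose b := (Num.sqrt v)^-1; have b0 : 0 < b by rewrite invr_gt0.
have b2 : b ^+ 2 = v^-1 by rewrite /b exprVn sqr_sqrtr// ltW.
have lnb : ln b = - (ln v / 2).
  by rewrite /b lnV ?posrE// -powR12_sqrt ?(ltW v0)// ln_powR mulrC.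
pose a i := s u i / (sigma * Num.sqrt v).
have sig2 : sigma ^+ 2 = 2^-1 by rewrite /sigma sqr_sqrtr// div1r.
pose L w := \prod_(i < N) gauss_lr (a i) b (G i w).
have L0 w : 0 <= L w by apply: prodr_ge0 => i _; exact: gauss_lr_ge0.
have mL : measurable_fun [set: Omega] L.
  apply: measurable_prod => i _; apply: measurableT_comp; last exact: hG.1.
  exact: measurable_gauss_lr.
pose g (y : rseq R) := (Num.max (err est N u y) delta) `^ alpha.
pose h (y : rseq R) := (Num.max (err est N u y) delta) `^ (- (alpha / rho)).
pose X w : rseq R := fun i => G i w.
have gX0 w : 0 < g (X w) by rewrite powR_gt0// lt_max delta0 orbT.
have mg : measurable_fun [set: rseq R] g by exact: mmaxpow.
have mgX : measurable_fun [set: Omega] (g \o X) by exact: measurableT_comp.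
have mhX : measurable_fun [set: Omega] (h \o X).
  by apply: measurableT_comp => //; exact: mmaxpow.
have intL : (\int[P]_w (L w `^ lam)%:E =
    (expR (N%:R * (lam * ln v / 2 - ln k / 2) -
      lam * (1 - lam) * (\sum_(n < N) s u n ^+ 2) / k))%:E)%E.
  rewrite (integral_prod_gauss_lr_powR P G hG)// b2 invrK lnb -/k.
  rewrite mulrNN [lam * (ln v / 2)]mulrA; apply/congr1/congr1/congr1/congr1.
  under eq_bigr do rewrite /a exprMn exprVn exprMn sig2 (sqr_sqrtr (ltW v0)).
  rewrite -mulr_suml; field.
  by rewrite !gt_eqF.
apply: (@le_trans _ _ (\int[P]_w (L w `^ lam)%:E)%E).
  rewrite intL lee_fin ler_expR lerB// ler_pM2r ?invr_gt0// ler_wpM2l//.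
  by rewrite mulr_ge0 ?(ltW lam0)// subr_ge0 ltW.
apply: (@le_trans _ _ (\int[P]_w ((t%:E * ((g (X w))%:E * (L w)%:E)) +
    (t `^ (- rho^-1))%:E * (h (X w))%:E))%E).
  apply: ge0_le_integral => //.
  - by move=> w _; rewrite lee_fin powR_ge0.
  - apply/measurable_EFinP; exact: (measurableT_comp (measurable_powR lam)).
  - apply: emeasurable_funD; apply: measurable_funeM.
      by apply: emeasurable_funM; exact/measurable_EFinP.
    exact/measurable_EFinP.
  - move=> w _; rewrite -!EFinM -EFinD lee_fin.
    have -> : h (X w) = g (X w) `^ (- rho^-1).
      by rewrite /h /g -powRrM mulrN.
    by rewrite (mulrC (g (X w))); exact: powR_le_tradeoff.
have hX0 w : 0 <= h (X w) by exact: powR_ge0.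
rewrite ge0_integralD//; last 4 first.
  - by move=> w _; rewrite !mule_ge0 ?lee_fin// ltW.
  - by apply: measurable_funeM; apply: emeasurable_funM; exact/measurable_EFinP.
  - by move=> w _; rewrite mule_ge0 ?lee_fin ?powR_ge0.
  - by apply: measurable_funeM; exact/measurable_EFinP.
rewrite ge0_integralZl//; last 3 first.
  - by apply: emeasurable_funM; exact/measurable_EFinP.
  - by move=> w _; rewrite mule_ge0 ?lee_fin// ltW.
  - by rewrite lee_fin ltW.
rewrite [X in (_ + X <= _)%E]ge0_integralZl//; last 3 first.
  - exact/measurable_EFinP.
  - by move=> w _; rewrite lee_fin.
  - by rewrite lee_fin powR_ge0.
apply: leeD2r; rewrite EFinM; apply: lee_wpmul2l; first by rewrite lee_fin ltW.
rewrite -(change_of_measure P G hG N a b (EFin \o g) b0); last 2 first.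
  - exact/measurable_EFinP.
  - by move=> y; rewrite lee_fin powR_ge0.
pose f w := `|est (received G 1 s u w) - u|.
(* Undoing the standardisation recovers the received signal; from coordinate N on both are pure
   noise. *)
have fE w : err est N u (fun i => if (i < N)%N then a i + b * G i w else 1 * G i w) = f w.
  rewrite /err /est_ref /f; congr (`|est _ - u|); apply/funext => i.
  rewrite /received -/sigma; case: (ltnP i N) => iN.
    rewrite add0r /a /b; field; by rewrite !gt_eqF.
  by rewrite sN// mul1r add0r.
have mf : measurable_fun [set: Omega] f.
  have := measurableT_comp (merr est N u mest)
    (measurableT_comp (measurable_affine_prefix N a b 1) mGseq).
  by apply: eq_measurable_fun => w _; rewrite /= -fE.
have intf : (\int[P]_w (f w `^ alpha)%:E <= e%:E)%E.
  by rewrite -mpaeE; apply: ereal_sup_ubound; exists u.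
apply: (@le_trans _ _ (\int[P]_w ((f w `^ alpha)%:E + (delta `^ alpha)%:E))%E).
  apply: ge0_le_integral => //.
  - by move=> w _; rewrite lee_fin powR_ge0.
  - apply: (measurableT_comp (f := EFin \o g)); first exact/measurable_EFinP.
    exact: (measurableT_comp (measurable_affine_prefix N a b 1) mGseq).
  - apply/measurable_EFinP; apply: measurable_funD => //.
    exact: (measurableT_comp (measurable_powR alpha)).
  - move=> w _; rewrite -EFinD /= lee_fin /g fE.
    rewrite /Num.max; case: ifP => _; first by rewrite lerDr powR_ge0.
    by rewrite lerDl powR_ge0.
rewrite ge0_integralD//; last 3 first.
  - by move=> w _; rewrite lee_fin powR_ge0.
  - by apply/measurable_EFinP; exact: (measurableT_comp (measurable_powR alpha)).
  - by move=> w _; rewrite lee_fin powR_ge0.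
rewrite EFinD leeD// integral_cst//=.
by rewrite probability_setT mule1.
Qed.

End error_lower_bound.

(** * Averaging over the parameter and optimizing over t *)

Section mpae_lower_bound.
Context {R : realType} {d : measure_display} {Omega : measurableType d}.
Variables (P : probability Omega R) (G : nat -> Omega -> R).
Hypothesis hG : std_gaussian_iid P G.
Variables (alpha rho v : R).
Hypotheses (alpha0 : 0 < alpha) (rho0 : alpha < rho) (v0 : 0 < v).

Lemma exists_powRN_le (eps : R) : 0 < eps ->
  exists M : nat, (0 < M)%N /\ (M%:R^-1 : R) `^ alpha <= eps.
Proof.
move=> eps0; pose M := (Num.truncn (eps `^ (- alpha^-1))).+1.
exists M; split => //; have M0 : 0 < M%:R :> R by rewrite ltr0n.
have epsE : eps = (eps `^ (alpha^-1)) `^ alpha.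
  by rewrite -powRrM mulVf ?gt_eqF// powRr1// ltW.
rewrite [leRHS]epsE; apply: (ge0_ler_powR (ltW alpha0)); rewrite ?nnegrE ?powR_ge0//.
rewrite -[leRHS]invrK lef_pV2 ?posrE ?invr_gt0 ?powR_gt0// -powRN.
by rewrite ltW// truncnS_gt.
Qed.

Let rho_gt0 : 0 < rho. Proof. exact: lt_trans rho0. Qed.
Let lam := (1 + rho)^-1.
Let k := 1 - lam + lam * v.
Let C := 3 / (1 - alpha / rho).

Let ratio1 : alpha / rho < 1. Proof. by rewrite ltr_pdivrMr// mul1r. Qed.
Let ratio0 : 0 < alpha / rho. Proof. by rewrite divr_gt0. Qed.
Let C0 : 0 < C. Proof. by rewrite divr_gt0// subr_gt0. Qed.

(** The pointwise bound is averaged over u = j / M with truncation at 1 / M. As alpha < rho, the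
    kernel exponent alpha / rho is below 1, so the average is at most [C] for every M; a large M
    makes the truncation cost at most eps. *)
Lemma mpae_tradeoff (N : nat) (s : R -> nat -> R) est (Q e t : R) :
  estimator_measurable est ->
  (forall u n, u \in `[0, 1[ -> (N <= n)%N -> s u n = 0) ->
  (forall u, u \in `[0, 1[ -> \sum_(n < N) s u n ^+ 2 <= Q) ->
  mpae P G 1 alpha (s, est) = e%:E -> 0 < t ->
  expR (N%:R * (lam * ln v / 2 - ln k / 2) - lam * (1 - lam) * Q / k) <=
  t * e + t `^ (- rho^-1) * C.
Proof.
move=> mest sN sQ mpaeE t0; set m := expR _.
apply/ler_addgt0Pr => eps eps0.
have [M [M0 Meps]] := exists_powRN_le (eps / t) (divr_gt0 eps0 t0).
have M0' : 0 < M%:R :> R by rewrite ltr0n.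
pose c := t `^ (- rho^-1).
pose h (j : 'I_M) w : R := (Num.max (`|est (fun i : nat =>
  if (i < N)%N then 0 + Num.sqrt (1 / 2) * Num.sqrt v * G i w
  else Num.sqrt (1 / 2) * G i w) - j%:R / M%:R|) M%:R^-1) `^ (- (alpha / rho)).
have hj (j : 'I_M) : (m%:E <= (t * (e + M%:R^-1 `^ alpha))%:E +
    c%:E * \int[P]_w (h j w)%:E)%E.
  have u01 : (j%:R / M%:R : R) \in `[0, 1[.
    rewrite in_itv/= divr_ge0//= ltr_pdivrMr// mul1r ltr_nat; exact: ltn_ord.
  apply: (@mpae_tradeoff_pointwise R d Omega P G hG alpha rho v rho_gt0 v0
    N s est Q e t _ _ mest u01) => //.
  - by move=> n; exact: sN.
  - exact: sQ.
  - by rewrite invr_gt0.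
have mh j : measurable_fun [set: Omega] (h j).
  apply: (measurableT_comp (measurable_powR _)); apply: measurable_maxr => //.
  apply: measurableT_comp => //; apply: measurable_funB => //.
  have mX : measurable_fun [set: Omega] (fun w => (fun i => G i w) : rseq R).
    by apply: measurable_rseq => i; exact: hG.1.
  exact: (measurableT_comp (measurable_est_ref v est N mest) mX).
have h0 j w : 0 <= h j w by exact: powR_ge0.
have sumh : (\sum_(j < M) \int[P]_w (h j w)%:E <= (M%:R * C)%:E)%E.
  rewrite -ge0_integral_sum//; last 2 first.
    by move=> j; exact/measurable_EFinP.
    by move=> j w _; rewrite lee_fin.
  apply: (@le_trans _ _ (\int[P]_w (cst (M%:R * C)%:E w))%E); last first.
    by rewrite integral_cst//= probability_setT mule1.
  apply: ge0_le_integral => //.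
  - by move=> w _; apply: sume_ge0 => j _; rewrite lee_fin.
  - by apply: emeasurable_sum => j; exact/measurable_EFinP.
  - by move=> w _; rewrite sumEFin lee_fin; exact: sum_grid_kernel_le.
have : (\sum_(j < M) m%:E <= \sum_(j < M) ((t * (e + M%:R^-1 `^ alpha))%:E +
    c%:E * \int[P]_w (h j w)%:E))%E by exact: lee_sum.
rewrite big_split/= -ge0_sume_distrr; last first.
  by move=> j _; apply: integral_ge0 => w _; rewrite lee_fin.
rewrite !sumEFin !sumr_const card_ord => H.
have {H}: (m *+ M <= (t * (e + M%:R^-1 `^ alpha)) *+ M + c * (M%:R * C)).
  rewrite -lee_fin EFinD EFinM; apply: (le_trans H); apply: leeD2l.
  by apply: lee_wpmul2l => //; rewrite lee_fin powR_ge0.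
rewrite -[m *+ M]mulr_natl -[(_ * (e + _)) *+ M]mulr_natl [c * _]mulrCA -mulrDr ler_pM2l// => H.
have td : t * M%:R^-1 `^ alpha <= eps by rewrite -ler_pdivlMl// mulrC.
by apply: (le_trans H); rewrite mulrDr addrAC lerD2l.
Qed.

Lemma mpae_lower_bound (N : nat) (s : R -> nat -> R) est (Q : R) :
  estimator_measurable est ->
  (forall u n, u \in `[0, 1[ -> (N <= n)%N -> s u n = 0) ->
  (forall u, u \in `[0, 1[ -> \sum_(n < N) s u n ^+ 2 <= Q) ->
  ((expR (- (N%:R * ((1 + rho) * ln k - ln v) / 2 + (rho / (1 + rho)) * Q / k
      + (1 + rho) * ln 2 + rho * ln C)))%:E <=
   mpae P G 1 alpha (s, est))%E.
Proof.
move=> mest sN sQ; case E : (mpae _ _ _ _ _) => [e| |]; last 2 first.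
- by rewrite leey.
- suff : (0 <= mpae P G 1 alpha (s, est))%E by rewrite E.
  apply: (@le_trans _ _ (\int[P]_w (`|est (received G 1 s 0 w) - 0| `^ alpha)%:E)%E).
    by apply: integral_ge0 => w _; rewrite lee_fin powR_ge0.
  by apply: ereal_sup_ubound; exists 0 => //=; rewrite in_itv/= lexx ltr01.
rewrite lee_fin; set m := N%:R * (lam * ln v / 2 - ln k / 2) - lam * (1 - lam) * Q / k.
(* This t makes the second term of [mpae_tradeoff] exactly half of the left side. *)
pose t := expR (- rho * (m - ln 2 - ln C)).
have := mpae_tradeoff N s est Q e t mest sN sQ E (expR_gt0 _).
rewrite -/m.
have -> : t `^ (- rho^-1) = expR m / 2 / C.
  rewrite /t -expRM (_ : _ * _ = m - ln 2 - ln C); last by field; rewrite gt_eqF.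
  by rewrite !expRD !expRN !lnK ?posrE.
rewrite divfK ?gt_eqF// -lerBlDr => H.
have {H}: expR m / 2 <= t * e by move: H; lra.
rewrite -ler_pdivrMl ?expR_gt0//; apply: le_trans.
have -> : t^-1 * (expR m / 2) = expR (rho * (m - ln 2 - ln C) + (m - ln 2)).
  by rewrite [RHS]expRD (expRB m (ln 2)) lnK ?posrE// /t mulNr expRN invrK.
rewrite ler_expR; set lC := ln C; set l2 := ln 2.
have k0 : 0 < k.
  apply: addr_gt0; last by rewrite mulr_gt0 ?invr_gt0 ?addr_gt0.
  by rewrite subr_gt0 invf_lt1 ?addr_gt0// ltrDl.
clearbody lC l2 k; rewrite /m /lam le_eqVlt; apply/orP; left; apply/eqP; field.
by rewrite !gt_eqF ?addr_gt0.
Qed.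

End mpae_lower_bound.

(** * Bounds on the exponent *)

Section converse.
Context {R : realType} {d : measure_display} {Omega : measurableType d}.
Variables (P : probability Omega R) (G : nat -> Omega -> R).
Hypothesis hG : std_gaussian_iid P G.

Lemma eneglog_le (x : R) (e : \bar R) :
  ((expR (- x))%:E <= e)%E -> (eneglog e <= x%:E)%E.
Proof.
case: e => [r||] xr; rewrite /eneglog; [|by rewrite leNye|by []].
rewrite lee_fin in xr; have r0 : 0 < r by exact: lt_le_trans (expR_gt0 _) xr.
by rewrite gt_eqF// lee_fin lerNl -ler_expR lnK.
Qed.

(** The exponent of [mpae_lower_bound] per unit time for N = 2T and Q = Gamma T, without the terms
    independent of T. *)
Definition exponent_bound (v Gamma rho : R) : R :=
  (1 + rho) * ln ((v + rho) / (1 + rho)) - ln v + Gamma * rho / (v + rho).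

Lemma achievable_le_bound (alpha rho v Gamma E : R) :
  0 < alpha -> alpha < rho -> 0 < v ->
  achievable P G alpha Gamma 1 1 E -> E <= exponent_bound v Gamma rho.
Proof.
move=> a0 ar v0 [Sfam [adm Ele]].
have r0 : 0 < rho by exact: lt_trans ar.
have r1 : 0 < 1 + rho by rewrite addr_gt0.
set H := exponent_bound v Gamma rho.
pose k := 1 - (1 + rho)^-1 + (1 + rho)^-1 * v.
have kE : k = (v + rho) / (1 + rho) by rewrite /k; field; rewrite gt_eqF.
pose A := (1 + rho) * ln k - ln v.
pose c0 := (1 + rho) * ln 2 + rho * ln (3 / (1 - alpha / rho)).
pose K := `|A| + `|c0|.
have K0 : 0 <= K by rewrite addr_ge0.
have bnd T : 0 < T ->
    (eneglog (mpae P G 1 alpha (Sfam T)) * (T^-1)%:E <= (H + K / T)%:E)%E.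
  move=> T0; have [_ [sN [sQ mest]]] := adm T T0.
  have sQ' u : u \in `[0, 1[ -> \sum_(n < ndim 1 T) (Sfam T).1 u n ^+ 2 <= Gamma * T.
    by move=> u01; have := sQ u u01; rewrite mulrC ler_pdivrMr.
  have := @mpae_lower_bound R d Omega P G hG alpha rho v a0 ar v0 (ndim 1 T)
    (Sfam T).1 (Sfam T).2 (Gamma * T) mest sN sQ'.
  rewrite -surjective_pairing => /eneglog_le; set X := (X in (_ <= X%:E)%E -> _) => XE.
  have -> : (H + K / T)%:E = ((T * H + K)%:E * (T^-1)%:E)%E.
    by rewrite -EFinM; congr EFin; field; rewrite gt_eqF.
  apply: lee_wpmul2r; first by rewrite lee_fin invr_ge0 ltW.
  apply: (le_trans XE); rewrite lee_fin /X -/k -/A.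
  have /andP[N1 N2] : (ndim 1 T)%:R <= 2 * 1 * T < (ndim 1 T).+1%:R.
    by apply: truncn_itv; rewrite !mulr_ge0// ltW.
  move: N1 N2; rewrite -(natr1 (ndim 1 T)); set n := (ndim 1 T)%:R => N1 N2.
  (* Rounding 2T down to n changes it by less than 1, whatever the sign of [A]. *)
  have nA : n * A / 2 <= T * A + `|A|.
    have : (n - 2 * T) * A <= `|A|.
      apply: (le_trans (ler_norm _)); rewrite normrM ler_piMl//.
      by rewrite ler_norml; apply/andP; split; lra.
    by have := normr_ge0 A; lra.
  have HE : T * H = T * A + rho / (1 + rho) * (Gamma * T) / k.
    rewrite /H /exponent_bound /A kE; set lk := ln _; set lv := ln v; field.
    by rewrite !gt_eqF ?addr_gt0.
  have c0n : c0 <= `|c0| by exact: ler_norm.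
  by rewrite HE /K -[leLHS]addrA -/c0; lra.
apply/ler_addgt0Pr => eps eps0.
(* From this M on K / T is at most eps, so a single supremum bounds the limsup. *)
pose M := 1 + K / eps.
have M0 : 0 < M by rewrite ltr_wpDr// divr_ge0// ltW.
rewrite -lee_fin; apply: (le_trans Ele).
apply: (@le_trans _ _ (ereal_sup [set (eneglog (mpae P G 1 alpha (Sfam T)) * (T^-1)%:E)%E
   | T in `[M, +oo[ ])).
  by apply: ereal_inf_lbound; exists M.
apply: ge_ereal_sup => z [T]; rewrite /= in_itv/= andbT => MT <-{z}.
have T0 : 0 < T by exact: lt_le_trans MT.
apply: (le_trans (bnd T T0)); rewrite lee_fin lerD2l ler_pdivrMr// mulrC -ler_pdivrMr//.
by apply: le_trans MT; rewrite /M lerDr.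
Qed.

Lemma exponent_bound_cvg (v Gamma alpha : R) : 0 < v -> 0 < alpha ->
  exponent_bound v Gamma x @[x --> alpha^'+] --> exponent_bound v Gamma alpha.
Proof.
move=> v0 a0; apply: cvg_at_right_filter.
have c1 (c : R) : (c + x) @[x --> alpha] --> c + alpha.
  by apply: cvgD; [exact: cvg_cst|exact: cvg_id].
apply: cvgD; first apply: cvgB.
- apply: cvgM; first exact: c1.
  apply: continuous_cvg; first by apply: continuous_ln; rewrite divr_gt0 ?addr_gt0.
  apply: cvgM; first exact: c1.
  by apply: cvgV; [rewrite gt_eqF// addr_gt0|exact: c1].
- exact: cvg_cst.
- apply: cvgM.
    by apply: cvgM; [exact: cvg_cst|exact: cvg_id].
  by apply: cvgV; [rewrite gt_eqF// addr_gt0|exact: c1].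
Qed.

(** [achievable_le_bound] requires rho > alpha; continuity in rho carries it to the endpoint. *)
Lemma F_exp_le_bound (alpha v Gamma : R) : 0 < alpha -> 0 < v ->
  (F_exp P G alpha Gamma <= (exponent_bound v Gamma alpha)%:E)%E.
Proof.
move=> a0 v0; apply: ge_ereal_sup => _ [E achE <-]; rewrite lee_fin.
have cv := exponent_bound_cvg v Gamma alpha v0 a0.
apply: (cvgr_to_ge cv); near=> rho.
by apply: (achievable_le_bound alpha rho) => //; near: rho; exact: nbhs_right_gt.
Unshelve. all: by end_near. Qed.

(* The stationary point of v |-> exponent_bound v Gamma rho is the positive root of
   v^2 + (rho - 1 - Gamma) v - rho = 0; it is (1 + rho) * beta0 - rho. *)
Lemma exponent_bound_E0 (rho Gamma : R) : 0 < rho -> 0 < Gamma ->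
  exists2 v : R, 0 < v & exponent_bound v Gamma rho = 2 * E0 rho Gamma.
Proof.
move=> r0 G0; pose S := 1 + rho + Gamma.
have S0 : 0 < S by rewrite !addr_gt0.
have r1 : 0 < 1 + rho by rewrite addr_gt0.
pose y := 1 + Gamma - rho.
(* The left form is the radicand of [beta0] up to scaling by S^2, the right one the discriminant of
   the quadratic; the latter shows D > |y|, hence v > 0. *)
have DE : S ^+ 2 - 4 * Gamma * rho = y ^+ 2 + 4 * rho by rewrite /S /y; ring.
pose D := Num.sqrt (S ^+ 2 - 4 * Gamma * rho).
have D2 : D ^+ 2 = y ^+ 2 + 4 * rho.
  by rewrite sqr_sqrtr// DE addr_ge0 ?sqr_ge0// mulr_ge0// ltW.
have yD : `|y| < D.
  rewrite -sqrtr_sqr ltr_sqrt; last by rewrite DE ltr_wpDl ?sqr_ge0// mulr_gt0.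
  by rewrite DE ltrDl mulr_gt0.
pose v := (y + D) / 2.
have v0 : 0 < v by move: yD; rewrite ltr_norml /v => /andP[? _]; lra.
have vq : v ^+ 2 + (rho - 1 - Gamma) * v - rho = 0.
  have -> : v ^+ 2 + (rho - 1 - Gamma) * v - rho = (D ^+ 2 - (y ^+ 2 + 4 * rho)) / 4.
    by rewrite /v /y; field.
  by rewrite D2 subrr mul0r.
have b0E : beta0 rho Gamma = (v + rho) / (1 + rho).
  rewrite /beta0 -/S.
  have -> : Num.sqrt (1 - 4 * Gamma * rho / S ^+ 2) = D / S.
    have -> : 1 - 4 * Gamma * rho / S ^+ 2 = (S ^+ 2 - 4 * Gamma * rho) * S^-1 ^+ 2.
      by field; rewrite gt_eqF.
    rewrite sqrtrM ?sqrtr_sqr; last by rewrite DE addr_ge0 ?sqr_ge0// mulr_ge0// ltW.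
    by rewrite gtr0_norm ?invr_gt0.
  rewrite /v /y /S; field.
  by rewrite !gt_eqF.
exists v => //; rewrite /exponent_bound /E0 b0E.
have vr0 : 0 < v + rho by rewrite addr_gt0.
(* Cleared of denominators, this identity and the one for Gamma * rho / (v + rho) below are the
   quadratic [vq]. *)
have -> : (v + rho) / (1 + rho) - Gamma / (1 + rho) = (v + rho) / (1 + rho) / v.
  apply/eqP; rewrite -subr_eq0.
  have -> : (v + rho) / (1 + rho) - Gamma / (1 + rho) - (v + rho) / (1 + rho) / v =
    (v ^+ 2 + (rho - 1 - Gamma) * v - rho) / (v * (1 + rho)).
    by field; rewrite !gt_eqF.
  by rewrite vq mul0r.
have -> : ln ((v + rho) / (1 + rho) / v) = ln ((v + rho) / (1 + rho)) - ln v.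
  by apply: ln_div; rewrite posrE// divr_gt0.
have -> : Gamma * rho / (v + rho) = 1 + Gamma - v.
  apply/eqP; rewrite -subr_eq0.
  have -> : Gamma * rho / (v + rho) - (1 + Gamma - v) =
    (v ^+ 2 + (rho - 1 - Gamma) * v - rho) / (v + rho).
    by field; rewrite !gt_eqF.
  by rewrite vq mul0r.
set lk := ln _; set lv := ln v; field.
by rewrite gt_eqF.
Qed.

End converse.

(** * Time rescaling and monotonicity of F(Gamma) / Gamma *)

Section time_rescaling.
Context {R : realType} {d : measure_display} {Omega : measurableType d}.
Variables (P : probability Omega R) (G : nat -> Omega -> R).

(* Stretching the duration by 1/c while keeping the signal spends the same
   energy at a power reduced by c. *)
Lemma admissible_rescale (Gamma c T : R) (S : system R) :
  0 < c -> c <= 1 -> 0 < T ->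
  admissible Gamma 1 (c * T) S -> admissible (c * Gamma) 1 T S.
Proof.
move=> c0 c1 T0 [ms [sN [sQ mest]]].
have cTT : c * T <= T by rewrite ler_piMl// ltW.
have NN : (ndim 1 (c * T) <= ndim 1 T)%N.
  by apply: le_truncn; rewrite ler_wpM2l.
split => //; split; first by move=> u n u01 nT; apply: sN => //; exact: leq_trans nT.
split => // u u01.
(* The coordinates gained by the longer duration carry no signal. *)
have -> : \sum_(n < ndim 1 T) S.1 u n ^+ 2 = \sum_(n < ndim 1 (c * T)) S.1 u n ^+ 2.
  rewrite -(big_mkord xpredT (fun n => S.1 u n ^+ 2)) (big_cat_nat _ NN)//=.
  rewrite big_mkord [X in _ + X](_ : _ = 0) ?addr0//.
  rewrite big_nat big1// => n /andP[nN _].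
  by rewrite sN// expr0n.
have := sQ u u01; rewrite invfM -mulrA ler_pdivrMl//.
Qed.

Lemma achievable_rescale (alpha Gamma c E : R) : 0 < c -> c <= 1 ->
  achievable P G alpha Gamma 1 1 E -> achievable P G alpha (c * Gamma) 1 1 (c * E).
Proof.
move=> c0 c1 [Sfam [adm Ele]]; exists (fun T => Sfam (c * T)); split.
  move=> T T0; apply: admissible_rescale => //; apply: adm; exact: mulr_gt0.
apply: le_ereal_inf_tmp => _ [M _ <-]; rewrite mulrC EFinM.
set F := ereal_sup _.
suff : (E%:E <= F * (c^-1)%:E)%E by rewrite -lee_pdivrMr ?invr_gt0// invrK.
apply: (le_trans Ele).
(* Durations above c M of the given family are those above M of the stretched one; dividing by T / c
   instead of T yields the factor c. *)
apply: (@le_trans _ _ (ereal_sup [set (eneglog (mpae P G 1 alpha (Sfam T)) * (T^-1)%:E)%E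
   | T in `[c * M, +oo[ ])).
  by apply: ereal_inf_lbound; exists (c * M).
apply: ge_ereal_sup => z [T]; rewrite /= in_itv/= andbT => MT <-{z}.
rewrite -lee_pdivrMr ?invr_gt0// invrK -muleA -EFinM.
apply: ereal_sup_ubound; exists (T / c).
  by rewrite /= in_itv/= andbT ler_pdivlMr// mulrC.
by rewrite mulrC divfK ?gt_eqF// invfM invrK.
Qed.

(** [achievable_rescale] with c = x / Gamma turns each exponent achievable at Gamma into one at
    x. *)
Lemma F_exp_rescale (alpha Gamma x : R) : 0 < x -> x <= Gamma ->
  (F_exp P G alpha Gamma * (Gamma^-1)%:E <= F_exp P G alpha x * (x^-1)%:E)%E.
Proof.
move=> x0 xG; have G0 : 0 < Gamma by exact: lt_le_trans xG.
rewrite lee_pdivrMr// -muleA -EFinM; apply: ge_ereal_sup => _ [E achE <-].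
have c0 : 0 < x / Gamma by rewrite divr_gt0.
rewrite (_ : x^-1 * Gamma = (x / Gamma)^-1); last by rewrite invfM invrK mulrC.
rewrite -lee_pdivrMr ?invr_gt0// invrK -EFinM.
apply: ereal_sup_ubound; exists (E * (x / Gamma)) => //.
rewrite mulrC -{1}[x](divfK (lt0r_neq0 G0)).
by apply: achievable_rescale; rewrite // ler_pdivrMr// mul1r.
Qed.

End time_rescaling.

Theorem mainTheorem1 (R : realType) (d : measure_display) (Omega : measurableType d)
  (P : probability Omega R) (G : nat -> Omega -> R) (alpha Gamma : R) :
  std_gaussian_iid P G -> 0 < alpha -> 0 < Gamma ->
  (F_exp P G alpha Gamma <= (2 * E0 alpha Gamma)%:E)%E /\
  (forall gamma_alpha : \bar R,
     (F_exp P G alpha x * (x^-1)%:E)%E @[x --> 0^'+] --> gamma_alpha ->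
     (F_exp P G alpha Gamma <= gamma_alpha * Gamma%:E)%E).
Proof.
move=> hG a0 G0; split.
  have [v v0 <-] := exponent_bound_E0 alpha Gamma a0 G0.
  exact: F_exp_le_bound.
move=> gamma_alpha cv; rewrite -lee_pdivrMr//.
(* For 0 < x <= Gamma the ratio at x dominates the one at Gamma, hence so does its limit at 0. *)
apply: (cvge_to_ge cv); near=> x; apply: F_exp_rescale.
  by near: x; exact: nbhs_right_gt.
by near: x; exact: nbhs_right_le.
Unshelve. all: by end_near. Qed.
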